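(* Let $k \geq 2$, let $q_1, \ldots, q_k$ be $k$ distinct prime numbers and $P = \prod_{i=1}^k q_i$. Let $r_1, \ldots, r_k$ be arbitrary integers (a residue class $r_i$ modulo $q_i$ for each $i$), and for $1 \le n \le P$ let $\gamma(n) = \#\{ i \in\{1,\dots,k\} : n \equiv r_i \pmod{q_i}\}$. Then, for every such choice of $r_1,\dots,r_k$, $$\#\{ n \in \{1,\dots,P\} : \gamma(n) \le 1\} = A_k(q_1,\dots,q_k) \quad\text{and}\quad \#\{ n \in \{1,\dots,P\} : \gamma(n) = 0\} = F_k(q_1,\dots,q_k),$$ where $A_k(q_1,\dots,q_k)$ is the determinant of the $k\times k$ matrix with diagonal entries $q_1,\dots,q_k$ and all off-diagonal entries equal to $1$, and $F_k(q_1,\dots,q_k) = (-1)^k \det N$, where $N$ is the $(k+1)\times(k+1)$ matrix whose first row consists entirely of ones and, for $1 \le i \le k$, whose row $i+1$ has entry $q_i$ in column $i$ and entry $1$ in every other column. *)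

(* Defs.v *)
From HB Require Import structures.
From mathcomp Require Import all_boot all_order all_algebra.

Set Implicit Arguments.
Unset Strict Implicit.
Unset Printing Implicit Defensive.

Import GRing.Theory.
Local Open Scope ring_scope.

Definition prodq (k : nat) (q : 'I_k -> nat) : nat := (\prod_(i < k) q i)%N.

Definition gamma (k : nat) (q : 'I_k -> nat) (r : 'I_k -> int) (n : nat) : nat :=
  #|[set i : 'I_k | (n%:Z == r i %[mod (q i)%:Z])%Z]|.

Definition mxA (k : nat) (q : 'I_k -> nat) : 'M[int]_k :=
  \matrix_(i < k, j < k) (if i == j then (q i)%:Z else 1).

Definition A (k : nat) (q : 'I_k -> nat) : int := \det (mxA q).

(* Indices start at 0: row [lift ord0 i] is the one carrying [q i], in the
   column of value [i] (one to the left of the diagonal). *)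
Definition mxN (k : nat) (q : 'I_k -> nat) : 'M[int]_k.+1 :=
  \matrix_(i < k.+1, j < k.+1)
    (if unlift ord0 i is Some i' then
       if (j == i' :> nat)%N then (q i')%:Z else 1
     else 1).

Definition F (k : nat) (q : 'I_k -> nat) : int := (-1) ^+ k * \det (mxN q).

(* Main.v *)
Require Import Defs.
From mathcomp Require Import all_boot all_order all_algebra.
From mathcomp Require Import ring.

(** By the Chinese remainder theorem a complete period of [n] is in bijection
    with the tuples of residues, so the number of [n] whose set of satisfied
    congruences is exactly [S] is the product of [q i - 1] over [i] outside [S].
    Summing over [S] empty, respectively of size at most one, gives
    [\prod_i (q i - 1)] and [\prod_i (q i - 1) + \sum_i \prod_(j != i) (q j - 1)].
    The determinants are evaluated to the same expressions by subtracting a row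
    of ones from all other rows. *)

Set Implicit Arguments.
Unset Strict Implicit.
Unset Printing Implicit Defensive.

Import GRing.Theory Num.Theory.
Local Open Scope ring_scope.

(** * Determinants *)

Section Determinants.

Variable R : comNzRingType.

(** Adding multiples of the top row to the rows below is left multiplication by a unipotent lower
    block triangular matrix. *)
Lemma det_col_mx_addrow k (u : 'rV[R]_(1 + k)) (v : 'cV[R]_k)
    (B : 'M[R]_(k, 1 + k)) :
  \det (col_mx u (v *m u + B)) = \det (col_mx u B).
Proof.
have -> : col_mx u (v *m u + B) = block_mx 1%:M 0 v 1%:M *m col_mx u B.
  by rewrite mul_block_col !mul1mx mul0mx addr0.
by rewrite det_mulmx det_lblock !det1 !mul1r.
Qed.

Lemma prod_ord_neq0 k (d : 'I_k.+1 -> R) :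
  \prod_(j | j != ord0) d j = \prod_(j < k) d (lift ord0 j).
Proof. by rewrite big_mkcond big_ord_recl /= mul1r. Qed.

Lemma prod_ord_neq_lift k (d : 'I_k.+1 -> R) (i : 'I_k) :
  \prod_(j | j != lift ord0 i) d j =
  d ord0 * \prod_(j < k | j != i) d (lift ord0 j).
Proof.
by rewrite big_mkcond big_ord_recl [in RHS]big_mkcond.
Qed.

(** Induction on [k], splitting the top row as [d ord0] times the first unit vector plus the row of
    ones. The unit vector leaves the smaller instance ([B]); with the row of ones on top ([C]),
    subtracting it from the other rows leaves a triangular matrix. *)
Lemma det_diag_add_ones k (d : 'I_k -> R) :
  \det (diag_mx (\row_i d i) + const_mx 1) =
  \prod_i d i + \sum_i \prod_(j | j != i) d j.
Proof.
elim: k d => [|k IHk] d; first by rewrite det_mx00 !big_ord0 addr0.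
pose d' := \row_(i < k) d (lift ord0 i).
pose D := diag_mx d' : 'M[R]_k.
pose B : 'M[R]_(1 + k) := block_mx 1%:M 0 (const_mx 1) (D + const_mx 1).
pose C : 'M[R]_(1 + k) :=
  col_mx (row_mx 1%:M (const_mx 1)) (row_mx (const_mx 1) (D + const_mx 1)).
have detB : \det B = \det (D + const_mx 1) by rewrite det_lblock det1 mul1r.
have detC : \det C = \prod_(i < k) d (lift ord0 i).
  have -> : C = col_mx (row_mx 1%:M (const_mx 1))
      (const_mx 1 *m row_mx 1%:M (const_mx 1) + row_mx 0 D).
    congr col_mx; rewrite mul_mx_row add_row_mx mulmx1 addr0 addrC.
    congr row_mx; congr (_ + _); apply/matrixP => i j.
    by rewrite !mxE big_ord1 !mxE mul1r.
  rewrite det_col_mx_addrow -[col_mx _ _]/(block_mx _ _ _ _) det_ublock det1.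
  by rewrite mul1r det_diag; apply: eq_bigr => i _; rewrite mxE.
(* Linearity in row 0 requires the other rows to agree; the top row [w] is arbitrary so that this
   serves both [B] and [C]. *)
have rowS (w : 'rV[R]_(1 + k)) :
    row' ord0 (col_mx w (row_mx (const_mx 1) (D + const_mx 1)) : 'M_k.+1) =
    row' ord0 (diag_mx (\row_i d i) + const_mx 1).
  apply/matrixP => i j; rewrite !mxE.
  case: (splitP (lift ord0 i : 'I_(1 + k))) => [i0|i']; first by rewrite ord1.
  move=> /= [ei]; rewrite !mxE.
  have {ei} -> : i = i' by apply: val_inj.
  case: splitP => j' ej; rewrite !mxE.
    have -> : j = ord0 by apply: val_inj; rewrite /= ej ord1.
    by rewrite mulr0n add0r.
  have -> : j = lift ord0 j' by apply: val_inj; rewrite /= ej.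
  by rewrite (inj_eq lift_inj).
have -> : \det (diag_mx (\row_i d i) + const_mx 1) =
    d ord0 * \det B + 1 * \det C.
  apply: (@determinant_multilinear _ k.+1 _ _ _ ord0).
  - apply/rowP => j; rewrite !mxE.
    case: (splitP (ord0 : 'I_(1 + k))) => // i0 _; rewrite !mxE.
    case: splitP => j' ej; rewrite !mxE.
      have -> : j = ord0 by apply: val_inj; rewrite /= ej ord1.
      by rewrite !ord1 !eqxx !mulr1n !mulr1.
    have -> : j = lift ord0 j' by apply: val_inj; rewrite /= ej.
    by rewrite /= mulr0n mulr0 mulr1.
  - exact: rowS.
  - exact: rowS.
rewrite detB detC IHk !big_ord_recl prod_ord_neq0.
under [X in _ = _ + (_ + X)]eq_bigr => i _ do rewrite prod_ord_neq_lift.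
by rewrite -mulr_sumr; ring.
Qed.

Lemma det_row_ones_diag k (d : 'I_k -> R) (N : 'M[R]_(1 + k)) :
    (forall j, N ord0 j = 1) ->
    (forall i j, N (lift ord0 i) j = 1 + d i *+ (i == j :> nat)) ->
  \det N = (-1) ^+ k * \prod_i d i.
Proof.
move=> N0 NS.
pose B : 'M[R]_(k, 1 + k) := \matrix_(i, j) (d i *+ (i == j :> nat)).
have -> : N = col_mx (const_mx 1) ((const_mx 1 : 'cV_k) *m const_mx 1 + B).
  apply/matrixP => i j; rewrite !mxE; case: splitP => i' ei; rewrite !mxE.
    have -> : i = ord0 by apply: val_inj; rewrite /= ei ord1.
    by rewrite N0.
  have -> : i = lift ord0 i' by apply: val_inj; rewrite /= ei.
  by rewrite NS big_ord1 !mxE mulr1.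
(* The last column of [B] is zero, so only the top entry 1 contributes. Its cofactor has sign
   [(-1) ^+ k], and its minor is the diagonal matrix of [d]. *)
rewrite det_col_mx_addrow (expand_det_col _ ord_max) big_ord_recl big1 => [|i _].
  rewrite addr0 mxE.
  case: (splitP (ord0 : 'I_(1 + k))) => // i0 _; rewrite !mxE mul1r /cofactor.
  rewrite add0n; congr (_ * _).
  have -> : \prod_i d i = \det (diag_mx (\row_i d i)).
    by rewrite det_diag; apply: eq_bigr => i _; rewrite mxE.
  congr (\det _); apply/matrixP => i j; rewrite !mxE.
  case: splitP => [i1|i1]; first by rewrite ord1.
  move=> /= [ei]; rewrite !mxE.
  have -> : i1 = i by apply: val_inj.
  by rewrite lift_max.
rewrite mxE; case: splitP => [i1|i1]; first by rewrite ord1.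
by rewrite !mxE /= (ltn_eqF (ltn_ord i1)) mulr0n mul0r.
Qed.

End Determinants.

Lemma detA k (q : 'I_k -> nat) :
  A q = \prod_i ((q i)%:Z - 1) + \sum_i \prod_(j | j != i) ((q j)%:Z - 1).
Proof.
rewrite -det_diag_add_ones /A; congr (\det _); apply/matrixP => i j.
by rewrite !mxE; case: eqP => _; rewrite ?mulr1n ?mulr0n ?subrK ?add0r.
Qed.

Lemma detF k (q : 'I_k -> nat) : F q = \prod_i ((q i)%:Z - 1).
Proof.
rewrite /F (@det_row_ones_diag _ _ (fun i => (q i)%:Z - 1)) => [|j|i j].
- by rewrite signrMK.
- by rewrite mxE unlift_none.
- rewrite mxE liftK eq_sym; case: eqP => _; last by rewrite addr0.
  by rewrite mulr1n addrC subrK.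
Qed.

(** * Counting residues *)

Local Open Scope nat_scope.

Lemma eq_mod_prod k (q : 'I_k -> nat) m n :
    (forall i j, i != j -> coprime (q i) (q j)) ->
    (forall i, m = n %[mod q i]) -> m = n %[mod \prod_i q i].
Proof.
elim: k q => [|k IHk] q co eqmn; first by rewrite big_ord0 !modn1.
rewrite big_ord_recl; apply/eqP; rewrite chinese_remainder.
  rewrite eqmn eqxx /=; apply/eqP; apply: IHk => // i j neq_ij.
  by apply: co; rewrite (inj_eq lift_inj).
apply: (big_ind (coprime (q ord0))) => [|x y cx cy|i _];
  by rewrite ?coprimen1 ?coprimeMr ?cx ?cy ?co.
Qed.

(* The tuples of residues are encoded as finite functions into ['I_(prod q)],
   with the bound [f i < q i] imposed by [family]. *)
Lemma sum_prod_residues k (q : 'I_k -> nat) (f : 'I_k -> nat -> nat) :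
    (forall i, 0 < q i) -> (forall i j, i != j -> coprime (q i) (q j)) ->
  \sum_(n < \prod_i q i) \prod_i f i (n %% q i) = \prod_i \sum_(a < q i) f i a.
Proof.
move=> q0 co; set P := \prod_i q i.
have P0 : 0 < P by rewrite prodn_gt0.
have le_qP i : q i <= P by rewrite dvdn_leq // /P (bigD1 i) //= dvdn_mulr.
have modP (n : nat) i : n %% q i < P by apply: leq_trans (le_qP i); rewrite ltn_mod.
pose Q i : pred 'I_P := fun a => a < q i.
pose h (n : 'I_P) : {ffun 'I_k -> 'I_P} := [ffun i => Ordinal (modP n i)].
have h_inj : injective h.
  move=> m n /ffunP eq_h; apply: val_inj.
  rewrite /= -(modn_small (ltn_ord m)) -(modn_small (ltn_ord n)).
  apply: eq_mod_prod => // i.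
  by have /(congr1 val) := eq_h i; rewrite !ffunE.
have cardQ i : #|Q i| = q i.
  rewrite -sum1_card -(big_ord_widen _ (fun=> 1) (le_qP i)).
  by rewrite sum1_card card_ord.
(* The residue map [h] is injective, and source and target both have [\prod_i q i] elements, so it
   is onto. *)
have imh : [set h n | n in 'I_P] = [set g in family Q].
  apply/eqP; rewrite eqEcard; apply/andP; split.
    apply/subsetP => _ /imsetP[n _ ->]; rewrite inE; apply/familyP => i.
    by rewrite ffunE unfold_in /Q /= ltn_mod.
  rewrite (card_imset _ h_inj) card_ord cardsE card_family.
  by rewrite foldrE big_image /= (eq_bigr q).
have -> : \prod_i \sum_(a < q i) f i a = \prod_i \sum_(a | Q i a) f i (a : 'I_P).
  by apply: eq_bigr => i _; rewrite (big_ord_widen _ (f i) (le_qP i)).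
(* Distributing the product over the sums gives a sum over residue tuples, which is then reindexed
   along [h]. *)
rewrite bigA_distr_big_dep /=.
rewrite -(eq_bigl _ _ (in_set (mem (family Q)))) -imh big_imset; last first.
  by move=> m n _ _; apply: h_inj.
by apply: eq_bigr => n _; apply: eq_bigr => i _; rewrite ffunE.
Qed.

(** Exactly one residue, [r] reduced modulo [m], satisfies the congruence. The boolean [b] says
    whether it is prescribed to hold or to fail. *)
Lemma sum_residue_eqb (m : nat) (r : int) (b : bool) : 0 < m ->
  \sum_(a < m) ((a%:Z == r %[mod m%:Z])%Z == b) = if b then 1 else m.-1.
Proof.
move=> m0.
have mz : m%:Z != 0%R by rewrite eqz_nat -lt0n.
have lt_rm : `|(r %% m%:Z)%Z|%N < m.
  by rewrite -ltz_nat gez0_abs ?modz_ge0 // ltz_pmod.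
pose a0 := Ordinal lt_rm.
have hitE (a : 'I_m) : (a%:Z == r %[mod m%:Z])%Z = (a == a0).
  rewrite modz_small ?lez_nat ?ltz_nat ?ltn_ord //.
  by rewrite -val_eqE /= -eqz_nat gez0_abs ?modz_ge0.
under eq_bigr => a _ do rewrite hitE.
case: b; last first.
  have -> : m.-1 = #|predC1 a0| by rewrite cardC1 card_ord.
  rewrite -sum1_card [RHS]big_mkcond /=.
  by apply: eq_bigr => a _; rewrite inE; case: (a == a0).
by rewrite (bigD1 a0) //= eqxx big1 // => a /negbTE ->.
Qed.

Section HitSets.

Variables (k : nat) (q : 'I_k -> nat) (r : 'I_k -> int).
Hypothesis q_prime : forall i, prime (q i).
Hypothesis q_inj : injective q.

Definition hits (n : nat) : {set 'I_k} :=
  [set i | (n%:Z == r i %[mod (q i)%:Z])%Z].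

(** The indicator of [hits n.+1 == S] is a product over [i] of factors depending only on [n] modulo
    [q i], so its sum factors. Indices in [S] contribute 1, the others [(q i).-1]. *)
Lemma sum_hits_eq (S : {set 'I_k}) :
  \sum_(n < prodq q) (hits n.+1 == S) = \prod_(i | i \notin S) (q i).-1.
Proof.
have q0 i : 0 < q i by apply: prime_gt0.
have co i j : i != j -> coprime (q i) (q j).
  by move=> neq; rewrite prime_coprime // dvdn_prime2 // (inj_eq q_inj).
(* The shift to [r i - 1] compensates for [n] running from 0 while the congruence is tested at
   [n.+1]. *)
pose f i (a : nat) : nat :=
  (a%:Z == r i - 1 %[mod (q i)%:Z])%Z == (i \in S).
transitivity (\sum_(n < prodq q) \prod_i f i (n %% q i)).
  apply: eq_bigr => n _.
  have -> : (hits n.+1 == S) =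
      [forall i, (n%:Z == r i - 1 %[mod (q i)%:Z])%Z == (i \in S)].
    have hitS i : (i \in hits n.+1) = (n%:Z == r i - 1 %[mod (q i)%:Z])%Z.
      rewrite inE !eqz_mod_dvd; congr (_ %| _)%Z.
      by rewrite -addn1 PoszD; ring.
    apply/eqP/forallP => [<- i|eqS]; first by rewrite hitS.
    by apply/setP => i; rewrite hitS; exact: (eqP (eqS i)).
  have fE i : f i (n %% q i) = ((n%:Z == r i - 1 %[mod (q i)%:Z])%Z == (i \in S)).
    by rewrite /f -modz_nat modz_mod.
  under eq_bigr => i _ do rewrite fE.
  case: forallP => [all_eq|]; first by rewrite big1 // => i _; rewrite all_eq.
  move=> /forallP; rewrite negb_forall => /existsP[i /negbTE neq_i].
  by rewrite (bigD1 i) //= neq_i.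
rewrite /prodq sum_prod_residues // [RHS]big_mkcond.
by apply: eq_bigr => i _; rewrite sum_residue_eqb //; case: (i \in S).
Qed.

End HitSets.

Lemma card_positive_ord P (p : pred nat) :
  #|[set n : 'I_P.+1 | (1 <= n) && p n]| = \sum_(n < P) p n.+1.
Proof.
rewrite -sum1dep_card big_mkcond big_ord_recl /= add0n.
by apply: eq_bigr => n _; case: (p _).
Qed.

(** The events of being empty or being a given singleton are mutually exclusive, so their indicators
    add up. This reduces the count to exact hit sets. *)
Lemma card_le1_eq (T : finType) (S : {set T}) :
  (#|S| <= 1) = (S == set0) + \sum_x (S == [set x]) :> nat.
Proof.
have [/eqP cS1|neq1] := boolP (#|S| == 1).
  rewrite -cards_eq0 cS1; move/eqP/cards1P: cS1 => [x ->].
  rewrite (bigD1 x) //= eqxx big1 // => y neq_yx.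
  by rewrite (inj_eq set1_inj) eq_sym (negbTE neq_yx).
rewrite big1 => [|x _]; last by case: (S =P [set x]) neq1 => // ->; rewrite cards1.
by rewrite addn0 -cards_eq0 leq_eqVlt (negbTE neq1) ltnS leqn0.
Qed.

Theorem theorem2 (k : nat) (q : 'I_k -> nat) (r : 'I_k -> int)
    (hk : (2 <= k)%N)
    (q_prime : forall i, prime (q i))
    (q_inj : injective q) :
  (#|[set n : 'I_(prodq q).+1 | (1 <= n)%N && (gamma q r n <= 1)%N]|%:Z = A q)%R /\
  (#|[set n : 'I_(prodq q).+1 | (1 <= n)%N && (gamma q r n == 0)%N]|%:Z = F q)%R.
Proof.
have gammaE n : gamma q r n = #|hits q r n| by [].
have predqE i : Posz (q i).-1 = ((q i)%:Z - 1)%R.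
  by rewrite predn_int // prime_gt0.
have prodE (p : pred 'I_k) :
    Posz (\prod_(i | p i) (q i).-1) = (\prod_(i | p i) ((q i)%:Z - 1))%R.
  rewrite -[LHS]natz natr_prod; apply: eq_bigr => i _.
  by rewrite natz predqE.
have sum0 : \sum_(n < prodq q) (hits q r n.+1 == set0) = \prod_i (q i).-1.
  by rewrite sum_hits_eq //; apply: eq_bigl => i; rewrite inE.
split; rewrite (card_positive_ord _ (fun n => gamma q r n <= 1),
                card_positive_ord _ (fun n => gamma q r n == 0)).
  under eq_bigr => n _ do rewrite gammaE card_le1_eq.
  (* The empty hit set gives the full product in [detA]; the hit set [[set i]] gives the product
     omitting [i]. *)
  rewrite big_split /= sum0 exchange_big detA PoszD prodE; congr (_ + _)%R.
  rewrite -[LHS]natz natr_sum; apply: eq_bigr => i _.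
  rewrite natz sum_hits_eq // prodE.
  by apply: eq_bigl => j; rewrite inE.
under eq_bigr => n _ do rewrite gammaE cards_eq0.
by rewrite sum0 prodE detF.
Qed.
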